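(* Let $M_{\rm b},M_{\rm o}$ be positive integers with $M_{\rm o}<M_{\rm b}$, and let $\sigma_{\rm b},\sigma_{\rm o},h_{\rm o},L_{\rm b}>0$ be fixed, with $\widetilde{L}_{\rm b/o}=L_{\rm b}/h_{\rm o}$. Consider the quantity $\eta$ defined in the context as a function $\eta=f(\widetilde{L}_{\rm o})$ of $\widetilde{L}_{\rm o}=L_{\rm o}/h_{\rm o}>0$ alone. Assume that, whenever $\widetilde{L}_{\rm o}^2M_{\rm o}>\widetilde{L}_{\rm b/o}^2M_{\rm b}$, one has $$\widetilde{L}_{\rm b/o}^2M_{\rm b}-\widetilde{L}_{\rm o}^2M_{\rm o}>4\widetilde{L}_{\rm b/o}^2\widetilde{L}_{\rm o}^2(M_{\rm o}-M_{\rm b}).$$ Then the minimum of the function $f$ is unique and reached when $$L_{\rm o}\sqrt{2M_{\rm o}-1}=L_{\rm b}\sqrt{2M_{\rm b}-1}.$$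
   Context: The quantity $\eta$ is an upper bound on a condition number, defined for positive integers $M_{\rm b},M_{\rm o}$ and positive reals $\sigma_{\rm b},\sigma_{\rm o},\widetilde{L}_{\rm b/o},\widetilde{L}_{\rm o}$ as follows. Let $\nu_{\rm b}=\nu(M_{\rm b})$, $\nu_{\rm o}=\nu(M_{\rm o})$ with $\nu(M)=\dfrac{2^{2M-1}[(M-1)!]^2}{(2M-2)!}>0$, and $$\alpha=\frac{\sigma_{\rm b}^2\nu_{\rm b}\widetilde{L}_{\rm b/o}}{\sigma_{\rm o}^2\nu_{\rm o}\widetilde{L}_{\rm o}}$$ (so $\alpha$ depends on $\widetilde{L}_{\rm o}$). Then $$\eta=1+\alpha\left(\frac{\widetilde{L}_{\rm o}^2}{M_{\rm b}}\right)^{M_{\rm b}}\left(\frac{M_{\rm o}}{\widetilde{L}_{\rm b/o}^2}\right)^{M_{\rm o}}\left(\frac{M_{\rm b}-M_{\rm o}}{\widetilde{L}_{\rm o}^2-\widetilde{L}_{\rm b/o}^2}\right)^{M_{\rm b}-M_{\rm o}}$$ if (i) $\widetilde{L}_{\rm o}^2M_{\rm o}>\widetilde{L}_{\rm b/o}^2M_{\rm b}$, (ii) $M_{\rm o}<M_{\rm b}$, and (iii) $\widetilde{L}_{\rm b/o}^2M_{\rm b}-\widetilde{L}_{\rm o}^2M_{\rm o}>4\widetilde{L}_{\rm b/o}^2\widetilde{L}_{\rm o}^2(M_{\rm o}-M_{\rm b})$ all hold, and $$\eta=1+\alpha\max\left\{\frac{(1+4\widetilde{L}_{\rm o}^2)^{M_{\rm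 o}}}{(1+4\widetilde{L}_{\rm b/o}^2)^{M_{\rm b}}},\;1\right\}$$ otherwise. *)

(* Defs.v *)
From HB Require Import structures.
From mathcomp Require Import all_boot all_order all_algebra.
From mathcomp Require Import reals.

Set Implicit Arguments.
Unset Strict Implicit.
Unset Printing Implicit Defensive.

Import Order.TTheory GRing.Theory Num.Theory.
Local Open Scope ring_scope.

(* Subtractions inside exponents and factorials are truncated; they are only
   meaningful for 1 <= M. *)
Definition nu (R : realType) (M : nat) : R :=
  2 ^+ (2 * M - 1)%N * ((M - 1)`!)%:R ^+ 2 / ((2 * M - 2)`!)%:R.

(* Lbo and Lo stand for the scaled lengths L_b / h_o and L_o / h_o. *)
Definition alpha (R : realType) (Mb Mo : nat) (sb so Lbo Lo : R) : R :=
  (sb ^+ 2 * nu R Mb * Lbo) / (so ^+ 2 * nu R Mo * Lo).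

Definition cond_iii (R : realType) (Mb Mo : nat) (Lbo Lo : R) : bool :=
  Lbo ^+ 2 * Mb%:R - Lo ^+ 2 * Mo%:R
    > 4 * Lbo ^+ 2 * Lo ^+ 2 * (Mo%:R - Mb%:R).

(* The truncated exponent (Mb - Mo)%N occurs only in the branch Mo < Mb, where
   moreover Lo ^+ 2 > Lbo ^+ 2, so no denominator vanishes for positive data. *)
Definition eta_bound (R : realType) (Mb Mo : nat) (sb so Lbo Lo : R) : R :=
  if [&& Lo ^+ 2 * Mo%:R > Lbo ^+ 2 * Mb%:R, (Mo < Mb)%N
       & cond_iii Mb Mo Lbo Lo]
  then 1 + alpha Mb Mo sb so Lbo Lo
           * (Lo ^+ 2 / Mb%:R) ^+ Mb
           * (Mo%:R / Lbo ^+ 2) ^+ Mo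
           * ((Mb%:R - Mo%:R) / (Lo ^+ 2 - Lbo ^+ 2)) ^+ (Mb - Mo)%N
  else 1 + alpha Mb Mo sb so Lbo Lo
           * Num.max ((1 + 4 * Lo ^+ 2) ^+ Mo / (1 + 4 * Lbo ^+ 2) ^+ Mb) 1.

Definition minimizer_on_pos (R : realType) (f : R -> R) (x : R) : Prop :=
  0 < x /\ forall y : R, 0 < y -> f x <= f y.

(* Main.v *)
Require Import Defs.
From HB Require Import structures.
From mathcomp Require Import all_boot all_order all_algebra.
From mathcomp Require Import reals ring lra zify.

Set Implicit Arguments.
Unset Strict Implicit.
Unset Printing Implicit Defensive.

Import Order.TTheory GRing.Theory Num.Theory.
Local Open Scope ring_scope.

(* Write t = Lo^2 and s = Lbo^2. Up to a positive factor independent of Lo,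
   (eta - 1)^2 is A(t)^2 / t for t > s Mb / Mo, where
   A(t) is the product of the three powers in the first branch, and 1 / t for
   t <= s Mb / Mo, since there the maximum equals 1 by Bernoulli's inequality.
   The two branches agree at t = s Mb / Mo, where A = 1, and the second one is
   decreasing. With q = 2 (Mb - Mo) and r = 2 Mo - 1, A(t)^2 / t is a constant
   times t^(q + r) / (t - s)^q, and the weighted AM-GM inequality for
   t = q ((t - s) / q) + r (s / r) shows that its unique minimum on t > s is at
   (t - s) / q = s / r, i.e. t = s (2 Mb - 1) / (2 Mo - 1) > s Mb / Mo. *)

(** * AM-GM with integer weights and two consequences *)

(** Plain AM-GM applied to [q] copies of [a] followed by [r] copies of [b]; since both blocks are
    nonempty, equality forces [a = b]. *)
Lemma leif_weighted_AGM (R : realFieldType) (q r : nat) (a b : R) :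
  (0 < q)%N -> (0 < r)%N -> 0 <= a -> 0 <= b ->
  a ^+ q * b ^+ r <= ((q%:R * a + r%:R * b) / (q + r)%:R) ^+ (q + r)
    ?= iff (a == b).
Proof.
move=> q0 r0 a0 b0.
pose E (i : 'I_(q + r)) := if (i < q)%N then a else b.
have El i : E (lshift r i) = a by rewrite /E /= ltn_ord.
have Er i : E (rshift q i) = b by rewrite /E /= ltnNge leq_addr.
have E0 : {in 'I_(q + r), forall i, 0 <= E i} by move=> i _; rewrite /E; case: ifP.
have := leif_AGM E0; rewrite card_ord.
have -> : \prod_(i in 'I_(q + r)) E i = a ^+ q * b ^+ r.
  rewrite big_split_ord /= (eq_bigr (fun=> a)) 1?[X in _ * X](eq_bigr (fun=> b)) //.
  by rewrite !prodr_const !card_ord.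
have -> : \sum_(i in 'I_(q + r)) E i = q%:R * a + r%:R * b.
  rewrite big_split_ord /= (eq_bigr (fun=> a)) 1?[X in _ + X](eq_bigr (fun=> b)) //.
  by rewrite !sumr_const !card_ord !mulr_natl.
congr (_ <= _ ?= iff _).
apply/forall_inP/eqP => [H|ab i _].
  have := H (lshift r (Ordinal q0)) isT.
  by move/forall_inP => /(_ (rshift q (Ordinal r0)) isT); rewrite El Er => /eqP.
by apply/forall_inP => j _; rewrite /E ab !if_same.
Qed.

(** Bernoulli's inequality for the exponent [(m + d) / m], raised to the power [m] to avoid roots.
    It is AM-GM for [m] copies of the left base and [d] copies of 1, whose mean is [1 + z]. *)
Lemma expr_le_exprD (R : realFieldType) (m d : nat) (z : R) :
  (0 < m)%N -> (0 < d)%N -> 0 <= z ->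
  (1 + (m + d)%:R / m%:R * z) ^+ m <= (1 + z) ^+ (m + d).
Proof.
move=> m0 d0 z0.
have M0 : 0 < m%:R :> R by rewrite ltr0n.
have a0 : 0 <= 1 + (m + d)%:R / m%:R * z :> R.
  by rewrite addr_ge0 ?ler01 // mulr_ge0 // divr_ge0 ?ler0n.
have [+ _] := leif_weighted_AGM m0 d0 a0 ler01.
rewrite expr1n mulr1.
suff -> : (m%:R * (1 + (m + d)%:R / m%:R * z) + d%:R * 1) / (m + d)%:R = 1 + z.
  by [].
rewrite natrD; field; rewrite -natrD !pnatr_eq0; lia.
Qed.

Lemma ltr_expr_ratio (R : realFieldType) (q r : nat) (s t : R) :
  (0 < q)%N -> (0 < r)%N -> 0 < s -> s < t -> t != s * (q + r)%:R / r%:R ->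
  (s * (q + r)%:R / r%:R) ^+ (q + r) / (s * q%:R / r%:R) ^+ q
    < t ^+ (q + r) / (t - s) ^+ q.
Proof.
move=> q0 r0 s0 st tN.
have Q0 : 0 < q%:R :> R by rewrite ltr0n.
have Rr0 : 0 < r%:R :> R by rewrite ltr0n.
have P0 : 0 < (q + r)%:R :> R by rewrite ltr0n addn_gt0 q0.
have ts : 0 < t - s by rewrite subr_gt0.
have a0 : 0 <= (t - s) / q%:R by rewrite divr_ge0 // ltW.
have b0 : 0 <= s / r%:R by rewrite divr_ge0 // ltW.
have := leif_weighted_AGM q0 r0 a0 b0 => /lt_leif.
(* The equality case of AM-GM would make [t] the excluded point. *)
have -> : ((t - s) / q%:R == s / r%:R) = false.
  apply/negP => /eqP e; move/eqP: tN; apply.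
  have -> : t = q%:R * ((t - s) / q%:R) + s by field; lra.
  by rewrite e natrD; field; lra.
have -> : (q%:R * ((t - s) / q%:R) + r%:R * (s / r%:R)) / (q + r)%:R
          = t / (q + r)%:R.
  by rewrite natrD; field; rewrite -?natrD; lra.
move=> H; rewrite ltr_pdivlMr ?exprn_gt0 //.
have {}H : ((t - s) / q%:R) ^+ q * (s / r%:R) ^+ r
           < (t / (q + r)%:R) ^+ (q + r) by rewrite H.
move: H; rewrite [(t / _) ^+ _]expr_div_n ltr_pdivlMr ?exprn_gt0 //.
suff -> : (s * (q + r)%:R / r%:R) ^+ (q + r) / (s * q%:R / r%:R) ^+ q * (t - s) ^+ q
          = ((t - s) / q%:R) ^+ q * (s / r%:R) ^+ r * (q + r)%:R ^+ (q + r) by [].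
rewrite !expr_div_n !exprMn [s ^+ (q + r)]exprD [r%:R ^+ (q + r)]exprD.
by field; rewrite !expf_neq0 ?gt_eqF.
Qed.

(** * Minimization in the squared variable [t] *)

Section Ratio.
Variables (R : realFieldType) (Mb Mo : nat).
Hypotheses (Mo_gt0 : (0 < Mo)%N) (Mo_lt_Mb : (Mo < Mb)%N).

Definition amplification (s t : R) : R :=
  (t / Mb%:R) ^+ Mb * (Mo%:R / s) ^+ Mo
    * ((Mb%:R - Mo%:R) / (t - s)) ^+ (Mb - Mo)%N.

Let M0 : 0 < Mb%:R :> R. Proof. by rewrite ltr0n; lia. Qed.
Let m0 : 0 < Mo%:R :> R. Proof. by rewrite ltr0n. Qed.
Let Mm : Mo%:R < Mb%:R :> R. Proof. by rewrite ltr_nat. Qed.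

(** The three bases become [s / Mo], [Mo / s] and [Mo / s], and the exponents satisfy
    [Mb = Mo + (Mb - Mo)], so everything cancels. *)
Lemma amplification_transition (s : R) : 0 < s ->
  amplification s (s * Mb%:R / Mo%:R) = 1.
Proof.
move=> s0; rewrite /amplification.
have -> : s * Mb%:R / Mo%:R / Mb%:R = s / Mo%:R by field; rewrite ?gt_eqF.
have -> : (Mb%:R - Mo%:R) / (s * Mb%:R / Mo%:R - s) = Mo%:R / s.
  by field; rewrite mulNr subr_eq0 !gt_eqF // ltr_pM2l.
rewrite -mulrA -exprD subnKC 1?ltnW // -exprMn.
have -> : s / Mo%:R * (Mo%:R / s) = 1 by field; rewrite ?gt_eqF.
by rewrite expr1n.
Qed.

Lemma amplification_gt0 (s t : R) : 0 < s -> s < t -> 0 < amplification s t.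
Proof.
move=> s0 st; have t0 := lt_trans s0 st.
rewrite /amplification mulr_gt0 ?mulr_gt0 // exprn_gt0 // divr_gt0 ?subr_gt0 //.
Qed.

(** Isolates the dependence on [t]. Squaring turns the factor [1 / Lo] into [1 / t], so the power of
    [t] is the integer [2 * Mb - 1]. *)
Lemma amplification_sqr (s t : R) : 0 < s -> s < t ->
  amplification s t ^+ 2 / t
  = (Mb%:R^-1 ^+ Mb * (Mo%:R / s) ^+ Mo * (Mb%:R - Mo%:R) ^+ (Mb - Mo)%N) ^+ 2
    * (t ^+ (2 * (Mb - Mo) + (2 * Mo - 1))
       / (t - s) ^+ (2 * (Mb - Mo))).
Proof.
move=> s0 st; have t0 := lt_trans s0 st.
have -> : t ^+ (2 * (Mb - Mo) + (2 * Mo - 1)) = (t ^+ Mb) ^+ 2 / t.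
  apply: (canRL (mulfK _)); first by rewrite gt_eqF.
  by rewrite -exprSr -exprM; congr (_ ^+ _); lia.
have -> : (t - s) ^+ (2 * (Mb - Mo)) = ((t - s) ^+ (Mb - Mo)%N) ^+ 2.
  by rewrite -exprM mulnC.
rewrite /amplification [(t / _) ^+ _]exprMn.
rewrite [((_ - _) / _) ^+ _]expr_div_n.
set u := (t - s) ^+ _; set v := (Mo%:R / s) ^+ _.
have u0 : u != 0 by rewrite expf_neq0 // gt_eqF // subr_gt0.
by field; rewrite u0 !gt_eqF.
Qed.

Definition critical_point (s : R) : R := s * (2 * Mb%:R - 1) / (2 * Mo%:R - 1).

Lemma amplification_sqr_lt (s t : R) : 0 < s -> s < t ->
  t != critical_point s ->
  amplification s (critical_point s) ^+ 2 / critical_point s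
    < amplification s t ^+ 2 / t.
Proof.
move=> s0 st tN.
pose q := (2 * (Mb - Mo))%N; pose r := (2 * Mo - 1)%N.
have rE : r%:R = 2 * Mo%:R - 1 :> R by rewrite /r natrB ?natrM //; lia.
have qrE : (q + r)%:R = 2 * Mb%:R - 1 :> R.
  have -> : (q + r = 2 * Mb - 1)%N by lia.
  by rewrite natrB ?natrM //; lia.
have m1 : 1 <= Mo%:R :> R by rewrite ler1n.
have cE : critical_point s = s * (q + r)%:R / r%:R by rewrite rE qrE.
have r0 : 0 < r%:R :> R by lra.
have csE : critical_point s - s = s * q%:R / r%:R.
  by rewrite cE natrD; field; lra.
have sc : s < critical_point s.
  by rewrite -subr_gt0 csE !mulr_gt0 ?invr_gt0 ?ltr0n //; lia.
rewrite !amplification_sqr // ltr_pM2l; last first.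
  by rewrite exprn_gt0 // !mulr_gt0 ?exprn_gt0 ?divr_gt0 ?invr_gt0 ?subr_gt0.
rewrite csE cE; apply: ltr_expr_ratio; rewrite -?cE //; lia.
Qed.

(* The square of (eta - 1) / K as a function of t = Lo^2, with K = Lo * alpha. *)
Definition eta_profile (s t : R) : R :=
  if s * Mb%:R < t * Mo%:R then amplification s t ^+ 2 / t else t^-1.

Lemma lt_amplification_domain (s t : R) :
  0 < s -> s * Mb%:R < t * Mo%:R -> s < t.
Proof. by move=> s0 H; move: (Mm) (m0); nra. Qed.

Lemma eta_profile_gt0 (s t : R) : 0 < s -> 0 < t -> 0 < eta_profile s t.
Proof.
move=> s0 t0; rewrite /eta_profile; case: ifPn => [H|_]; last by rewrite invr_gt0.
by rewrite divr_gt0 // exprn_gt0 // amplification_gt0 // lt_amplification_domain.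
Qed.

Lemma eta_profile_lt (s t : R) : 0 < s -> 0 < t -> t != critical_point s ->
  eta_profile s (critical_point s) < eta_profile s t.
Proof.
move=> s0 t0 tN; rewrite /eta_profile.
have m1 : 1 <= Mo%:R :> R by rewrite ler1n.
(* The critical point lies inside the first branch: cross-multiplying,
   [Mb (2 Mo - 1) < Mo (2 Mb - 1)] amounts to [Mo < Mb]. *)
have cs : s * Mb%:R / Mo%:R < critical_point s.
  rewrite /critical_point -!mulrA ltr_pM2l // ltr_pdivrMr // mulrAC.
  by rewrite ltr_pdivlMr; move: (Mm) m1; nra.
rewrite -ltr_pdivrMr // cs; case: ifPn => [H|].
  by apply: amplification_sqr_lt => //; apply: lt_amplification_domain H.
rewrite -leNgt => le.
(* In the second branch, compare through the transition point, where the first formula equals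
   [1 / t1], which is at most [1 / t]. *)
pose t1 := s * Mb%:R / Mo%:R.
have st1 : s < t1 by rewrite /t1 ltr_pdivlMr // ltr_pM2l.
apply: (@lt_le_trans _ _ (amplification s t1 ^+ 2 / t1)).
  by apply: amplification_sqr_lt => //; rewrite lt_eqF.
rewrite amplification_transition // expr1n mul1r lef_pV2 ?posrE ?(lt_trans s0 st1) //.
by rewrite ler_pdivlMr.
Qed.

End Ratio.

(** * Return from the profile to the bound itself *)

Lemma nu_gt0 (R : realType) (M : nat) : 0 < nu R M.
Proof.
by rewrite /nu divr_gt0 ?mulr_gt0 ?exprn_gt0 ?ltr0n ?fact_gt0.
Qed.

(** The implication assumed on [cond_iii] leaves condition (i) alone to select the branch, as in
    [eta_profile]. *)
Lemma eta_bound_profile (R : realType) (Mb Mo : nat) (sb so Lbo Lo : R) :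
  (0 < Mo)%N -> (Mo < Mb)%N -> 0 < Lbo -> 0 < Lo ->
  (Lbo ^+ 2 * Mb%:R < Lo ^+ 2 * Mo%:R -> cond_iii Mb Mo Lbo Lo) ->
  eta_bound Mb Mo sb so Lbo Lo
  = 1 + sb ^+ 2 * nu R Mb * Lbo / (so ^+ 2 * nu R Mo)
        * Num.sqrt (eta_profile Mb Mo (Lbo ^+ 2) (Lo ^+ 2)).
Proof.
move=> m0 mM Lb0 Lo0 Hiii.
have sq (x : R) : 0 < x -> Num.sqrt (x ^+ 2) = x.
  by move=> x0; rewrite sqrtr_sqr gtr0_norm.
have aE : alpha Mb Mo sb so Lbo Lo
    = sb ^+ 2 * nu R Mb * Lbo / (so ^+ 2 * nu R Mo) * Lo^-1.
  by rewrite /alpha invfM mulrA.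
rewrite /eta_bound /eta_profile aE mM /=.
case: ifPn => [/andP[H _]|N].
  have st : Lbo ^+ 2 < Lo ^+ 2.
    by apply: (lt_amplification_domain m0 mM) => //; rewrite exprn_gt0.
  rewrite H -[amplification _ _ _ _ ^+ 2 / _]expr_div_n sq; last first.
    by rewrite mulr_gt0 ?invr_gt0 ?amplification_gt0 ?exprn_gt0.
  by rewrite /amplification; congr (1 + _); ring.
have {}N : Lo ^+ 2 * Mo%:R <= Lbo ^+ 2 * Mb%:R.
  by rewrite leNgt; apply: contra N => H; rewrite H Hiii.
rewrite ltNge N /= -[(Lo ^+ 2)^-1]exprVn sq ?invr_gt0 // max_r ?mulr1 //.
(* The maximum is 1: failure of (i) bounds [1 + 4 * Lo ^+ 2] by [1 + Mb / Mo * z] with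
   [z = 4 * Lbo ^+ 2], and Bernoulli bounds the [Mo]-th power of that by [(1 + z) ^+ Mb]. *)
have z0 : 0 <= 4 * Lbo ^+ 2 by rewrite mulr_ge0 ?sqr_ge0.
rewrite ler_pdivrMr ?mul1r; last by rewrite exprn_gt0 // ltr_wpDr.
have M0 : 0 < Mo%:R :> R by rewrite ltr0n.
have d0 : (0 < Mb - Mo)%N by lia.
have := expr_le_exprD m0 d0 z0; rewrite subnKC 1?ltnW //; apply: le_trans.
have le : 1 + 4 * Lo ^+ 2 <= 1 + Mb%:R / Mo%:R * (4 * Lbo ^+ 2).
  by rewrite lerD2l [_ / _ * _]mulrCA ler_pM2l // mulrAC ler_pdivlMr // [Mb%:R * _]mulrC.
have x0 : 0 <= 1 + 4 * Lo ^+ 2 by rewrite addr_ge0 // mulr_ge0 ?sqr_ge0.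
by rewrite lerXn2r // nnegrE // (le_trans x0).
Qed.

Theorem corollary2 (R : realType) (Mb Mo : nat) (sb so ho Lb : R)
  (Mb_gt0 : (0 < Mb)%N) (Mo_gt0 : (0 < Mo)%N) (Mo_lt_Mb : (Mo < Mb)%N)
  (sb_gt0 : 0 < sb) (so_gt0 : 0 < so) (ho_gt0 : 0 < ho) (Lb_gt0 : 0 < Lb)
  (Hiii : forall x : R, 0 < x ->
     x ^+ 2 * Mo%:R > (Lb / ho) ^+ 2 * Mb%:R ->
     (Lb / ho) ^+ 2 * Mb%:R - x ^+ 2 * Mo%:R
       > 4 * (Lb / ho) ^+ 2 * x ^+ 2 * (Mo%:R - Mb%:R)) :
  let f : R -> R := fun x => eta_bound Mb Mo sb so (Lb / ho) x in
  (exists! x : R, minimizer_on_pos f x) /\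
  (forall Lo : R, 0 < Lo ->
     (minimizer_on_pos f (Lo / ho) <->
      Lo * Num.sqrt (2 * Mo%:R - 1) = Lb * Num.sqrt (2 * Mb%:R - 1))).
Proof.
move=> f; set l := Lb / ho.
have l0 : 0 < l by rewrite divr_gt0.
have s0 : 0 < l ^+ 2 by rewrite exprn_gt0.
have m1 : 1 <= Mo%:R :> R by rewrite ler1n.
have M1 : 1 <= Mb%:R :> R by rewrite ler1n.
have rm0 : 0 < Num.sqrt (2 * Mo%:R - 1) :> R by rewrite sqrtr_gt0; lra.
have rM0 : 0 < Num.sqrt (2 * Mb%:R - 1) :> R by rewrite sqrtr_gt0; lra.
pose x0 : R := l * Num.sqrt (2 * Mb%:R - 1) / Num.sqrt (2 * Mo%:R - 1).
have x0_gt0 : 0 < x0 by apply: divr_gt0 => //; apply: mulr_gt0.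
have x0E : x0 ^+ 2 = critical_point Mb Mo (l ^+ 2).
  by rewrite /x0 expr_div_n exprMn !sqr_sqrtr //; lra.
have fE x : 0 < x -> f x = 1 + sb ^+ 2 * nu R Mb * l / (so ^+ 2 * nu R Mo)
    * Num.sqrt (eta_profile Mb Mo (l ^+ 2) (x ^+ 2)).
  by move=> x_gt0; apply: eta_bound_profile => //; apply: Hiii.
(* Strictness away from [x0] gives existence and uniqueness together; squaring is injective on
   positive reals, so [y != x0] passes to the squares. *)
have f_lt y : 0 < y -> y != x0 -> f x0 < f y.
  move=> y0 yN; rewrite !fE // ltrD2l ltr_pM2l; last first.
    by rewrite !(nu_gt0, divr_gt0, mulr_gt0, exprn_gt0).
  rewrite ltr_sqrt ?eta_profile_gt0 ?exprn_gt0 // x0E eta_profile_lt ?exprn_gt0 //.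
  by rewrite -x0E eqrXn2 // ltW.
have minE x : minimizer_on_pos f x <-> x = x0.
  split=> [[x_gt0 xmin]|->].
    by apply/eqP/negPn/negP => /(f_lt _ x_gt0); rewrite ltNge xmin.
  split=> // y y0; have [->//|yN] := eqVneq y x0.
  exact/ltW/f_lt.
split; first by exists x0; split=> [|x /minE ->]; first exact/minE.
move=> Lo Lo0; split=> [/minE|] H.
  have -> : Lo = Lo / ho * ho by rewrite divfK ?gt_eqF.
  by rewrite H /x0 /l; field; rewrite !gt_eqF.
apply/minE; rewrite /x0 /l [_ * Num.sqrt _]mulrAC -H.
by field; rewrite !gt_eqF.
Qed.
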